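(* For any non-negative integers $m$ and $n$, we have $$s_{((2m+1)^n)}(x_1,x_1^{-1},x_2,x_2^{-1},\dots,x_n,x_n^{-1})=\mathrm{sp}_{(m^n)}(x_1,x_2,\dots,x_n)\;o^{\mathrm{even}}_{((m+1)^n)}(x_1,x_2,\dots,x_n).$$
   Context: For integers $M,k\ge 0$, $(M^k)$ denotes the sequence $(M,M,\dots,M)$ with $k$ entries; a partition (a non-increasing sequence of non-negative integers) is padded with zeros to the number of variables when needed. Schur function: for a partition $\lambda=(\lambda_1,\lambda_2,\dots,\lambda_N)$, $$s_\lambda(x_1,\dots,x_N)=\frac{\det_{1\le h,t\le N}\left(x_h^{\lambda_t+N-t}\right)}{\det_{1\le h,t\le N}\left(x_h^{N-t}\right)}.$$ The denominator cancels out, so this is a polynomial in $x_1,\dots,x_N$. On the left-hand side of the claim it is taken in $2n$ variables ($N=2n$), specialized to $x_1,x_1^{-1},\dots,x_n,x_n^{-1}$. Symplectic character: for a partition $\lambda=(\lambda_1,\dots,\lambda_N)$, $$\mathrm{sp}_\lambda(x_1,\dots,x_N)=\frac{\det_{1\le h,t\le N}\left(x_h^{\lambda_t+N-t+1}-x_h^{-(\lambda_t+N-t+1)}\right)}{\det_{1\le h,t\le N}\left(x_h^{N-t+1}-x_h^{-(N-t+1)}\right)}.$$ Even orthogonal character: for a non-increasing sequence $\lambda=(\lambda_1,\dots,\lambda_N)$ of positive integers or half-integers (a half-integer being a positive odd integer divided by 2), $$o^{\mathrm{even}}_\lambda(x_1,\dots,x_N)=2\,\frac{\det_{1\le h,t\le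 N}\left(x_h^{\lambda_t+N-t}+x_h^{-(\lambda_t+N-t)}\right)}{\det_{1\le h,t\le N}\left(x_h^{N-t}+x_h^{-(N-t)}\right)}.$$ In the claim, both of these characters are Laurent polynomials in the variables $x_1,\dots,x_n$ (so $N=n$), and hence are well-defined for any choice of non-zero variables.
   Formalization: For n = 0 the stated formula gives o^even = 2 (empty determinants are 1), so the claim would read 1 = 1·2; the even orthogonal character in zero variables is instead taken to be 1. For n ≥ 1 the definition is as stated. *)

(* Defs.v *)
From HB Require Import structures.
From mathcomp Require Import all_boot all_order all_algebra.
From mathcomp Require Import fraction.
From mathcomp Require Import mpoly.

Set Implicit Arguments.
Unset Strict Implicit.
Unset Printing Implicit Defensive.

Import GRing.Theory.
Local Open Scope ring_scope.

(* A partition is a [seq nat]; [nth 0%N lam t] pads it with zeros.  The column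
   index [t : 'I_N] starts at 0, so the exponents N - t and N - t + 1 of the
   usual 1-based formulas become [N - t.+1] and [N - t] (no truncation
   occurs, since t < N). *)

Definition schur (F : fieldType) (N : nat) (lam : seq nat)
    (x : 'I_N -> F) : F :=
  \det (\matrix_(h < N, t < N) x h ^+ (nth 0 lam t + (N - t.+1))%N)
  / \det (\matrix_(h < N, t < N) x h ^+ (N - t.+1)%N).

Definition symplectic (F : fieldType) (N : nat) (lam : seq nat)
    (x : 'I_N -> F) : F :=
  \det (\matrix_(h < N, t < N)
          (x h ^+ (nth 0 lam t + (N - t))%N - x h ^- (nth 0 lam t + (N - t))%N))
  / \det (\matrix_(h < N, t < N) (x h ^+ (N - t)%N - x h ^- (N - t)%N)).

(* Integral [lam] only: half-integers would require square roots of the x_h.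
   The factor 2 compensates the last column of the denominator, whose entries
   are x_h^0 + x_h^0 = 2.  For N = 0 there is no such column (both
   determinants are 1) and the factor is 1, so that the character of the empty
   sequence in no variables is 1. *)
Definition even_orthogonal (F : fieldType) (N : nat) (lam : seq nat)
    (x : 'I_N -> F) : F :=
  (if N is 0 then 1 else 2)
  * (\det (\matrix_(h < N, t < N)
             (x h ^+ (nth 0 lam t + (N - t.+1))%N
              + x h ^- (nth 0 lam t + (N - t.+1))%N))
     / \det (\matrix_(h < N, t < N) (x h ^+ (N - t.+1)%N + x h ^- (N - t.+1)%N))).

Lemma half_ord_subproof (n : nat) (i : 'I_n.*2) : (i./2 < n)%N.
Proof. by rewrite ltn_half_double. Qed.

Definition half_ord (n : nat) (i : 'I_n.*2) : 'I_n :=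
  Ordinal (half_ord_subproof i).

(* The 2n values x_1, x_1^-1, x_2, x_2^-1, ..., x_n, x_n^-1, in this order. *)
Definition with_inverses (F : fieldType) (n : nat) (x : 'I_n -> F)
    (i : 'I_n.*2) : F :=
  if odd i then (x (half_ord i))^-1 else x (half_ord i).

(* The field Q(x_1, ..., x_n), which contains the Laurent polynomials. *)
Definition ratfun (n : nat) : fieldType := {fraction {mpoly rat[n]}}.

(* The indeterminates; at this point, and at [with_inverses] of it, none of the
   denominators above vanishes. *)
Definition indet (n : nat) (i : 'I_n) : ratfun n :=
  tofrac ('X_i : {mpoly rat[n]}).

(* Main.v *)
(** With [c = m + n], scaling the row of each variable [z] by [z ^- c] turns the
    exponents in the numerator of the Schur function into
    [+-(m + 1), ..., +-(m + n)].  Up to reversing the last [n] columns the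
    numerator is then [\det (block_mx A B B A) = \det (A - B) * \det (A + B)],
    the product of the two numerators on the right.  Centering the exponents of
    the denominator with [c = n - 1] instead gives [-(n - 1), ..., n].
    Subtracting the rows of the [x^-1] from those of the [x], and then adding to
    the column of exponent [-e] that of exponent [e] for [0 < e < n], makes it
    block triangular; the diagonal blocks are the two denominators on the right,
    the orthogonal one with its constant column [2] replaced by [1]. *)

Require Import Defs.
From HB Require Import structures.
From mathcomp Require Import all_boot all_order all_algebra.
From mathcomp Require Import all_fingroup.
From mathcomp Require Import fraction.
From mathcomp Require Import mpoly.
From mathcomp Require Import zify ring.

Set Implicit Arguments.
Unset Strict Implicit.
Unset Printing Implicit Defensive.

Import GRing.Theory.
Local Open Scope ring_scope.

(** Subtracting the second block row from the first, then adding the first block column to the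
    second, leaves a block lower triangular matrix. *)
Lemma det_block_swap (R : comPzRingType) (n : nat) (A B : 'M[R]_n) :
  \det (block_mx A B B A) = \det (A - B) * \det (A + B).
Proof.
have E : block_mx 1%:M (- 1%:M) 0 1%:M *m block_mx A B B A *m
         block_mx 1%:M 1%:M 0 1%:M = block_mx (A - B) 0 B (A + B).
  rewrite !mulmx_block !mul0mx !mulmx0 !mul1mx !mulmx1 !mulNmx !mul1mx.
  by rewrite !addr0 !add0r -(opprB A B) subrr [B + A]addrC.
have /(congr1 determinant) := E.
by rewrite !det_mulmx !det_ublock !det1 !mul1r !mulr1 det_lblock.
Qed.

Lemma det_scale_rows (R : comPzRingType) (n : nat) (d : 'I_n -> R)
    (A : 'M[R]_n) :
  \det (\matrix_(i, j) (d i * A i j)) = (\prod_i d i) * \det A.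
Proof.
have -> : \matrix_(i, j) (d i * A i j) = diag_mx (\row_i d i) *m A.
  by apply/matrixP => i j; rewrite mul_diag_mx !mxE.
by rewrite det_mulmx det_diag; congr (_ * _); apply: eq_bigr => i _; rewrite mxE.
Qed.

Lemma det_scale_cols (R : comPzRingType) (n : nat) (d : 'I_n -> R)
    (A : 'M[R]_n) :
  \det (\matrix_(i, j) (A i j * d j)) = (\prod_i d i) * \det A.
Proof.
rewrite -(det_tr A) -det_scale_rows -det_tr; congr (\det _).
by apply/matrixP => i j; rewrite !mxE mulrC.
Qed.

Definition rev_perm (n : nat) : 'S_n := perm (@rev_ord_inj n).

Lemma mulmx_rev_perm (R : pzSemiRingType) (p n : nat) (A : 'M[R]_(p, n)) i j :
  (A *m perm_mx (rev_perm n)) i j = A i (rev_ord j).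
Proof.
have -> : rev_perm n = ((rev_perm n)^-1)%g.
  by apply/permP => k; apply: (@perm_inj _ (rev_perm n)); rewrite permKV !permE rev_ordK.
by rewrite -col_permE mxE permE.
Qed.

(** Permuting the variables permutes the rows of both determinants, so the same sign appears twice
    and cancels. *)
Lemma schur_reindex (F : fieldType) (N N' : nat) (f : 'I_N -> 'I_N')
    (lam : seq nat) (y : 'I_N' -> F) :
  bijective f -> schur lam (y \o f) = schur lam y.
Proof.
move=> bij_f; have eqN : N = N' by have := bij_eq_card bij_f; rewrite !card_ord.
case: N' / eqN f y bij_f => f y /bij_inj inj_f; pose s := perm inj_f.
have rowsE (e : 'I_N -> nat) : \det (\matrix_(h, t) (y \o f) h ^+ e t) =
    (-1) ^+ s * \det (\matrix_(h, t) y h ^+ e t).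
  rewrite -det_perm -det_mulmx -row_permE; congr (\det _).
  by apply/matrixP => i j; rewrite !mxE permE.
by rewrite /schur !rowsE -mulf_div divff ?mul1r ?signr_eq0.
Qed.

(** All the [x j] come first and then all their inverses, so that the determinants split into [n] by
    [n] blocks. *)
Definition blocks_with_inverses (F : fieldType) (n : nat) (x : 'I_n -> F)
    (i : 'I_(n + n)) : F :=
  match split i with inl j => x j | inr j => (x j)^-1 end.

Lemma schur_with_inverses (F : fieldType) (n : nat) (lam : seq nat)
    (x : 'I_n -> F) :
  schur lam (with_inverses x) = schur lam (blocks_with_inverses x).
Proof.
have f_lt (i : 'I_(n + n)) :
    (match split i with inl j => j.*2 | inr j => j.*2.+1 end < n.*2)%N.
  by case: (split i) => j; have := ltn_ord j; lia.
pose f i := Ordinal (f_lt i).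
have inj_f : injective f.
  move=> i j /(congr1 val) /=; case: (split_ordP i) => i' ->;
    case: (split_ordP j) => j' ->; rewrite ?(unsplitK (inl _)) ?(unsplitK (inr _)).
  - by move/double_inj/val_inj->.
  - by move/(congr1 odd); rewrite /= !odd_double.
  - by move/(congr1 odd); rewrite /= !odd_double.
  - by case=> /double_inj/val_inj->.
have bij_f : bijective f by apply: inj_card_bij => //; rewrite !card_ord addnn.
have yE i : with_inverses x (f i) = blocks_with_inverses x i.
  rewrite /with_inverses /blocks_with_inverses.
  have -> : half_ord (f i) = match split i with inl j => j | inr j => j end.
    apply: val_inj => /=.
    by case: (split i) => j; rewrite /= ?doubleK ?uphalf_double.
  by rewrite /=; case: (split i) => j; rewrite /= odd_double.
rewrite -(schur_reindex _ _ bij_f) /schur; congr (_ / _); congr (\det _);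
  by apply/matrixP => i j; rewrite !mxE /= yE.
Qed.

(** The row factors of [x i] and of its inverse cancel in pairs. This is what allows the exponents
    to be centered. *)
Lemma det_scale_with_inverses (F : fieldType) (n c : nat) (x : 'I_n -> F)
    (A : 'M[F]_(n + n)) :
  (forall i, x i != 0) ->
  \det (\matrix_(i, j) (blocks_with_inverses x i ^+ c * A i j)) = \det A.
Proof.
move=> x_neq0; rewrite det_scale_rows [\prod_i _](_ : _ = 1) ?mul1r //.
rewrite big_split_ord /= -big_split /= big1 // => i _.
rewrite /blocks_with_inverses (unsplitK (inl _)) (unsplitK (inr _)).
by rewrite -exprMn divff ?expr1n.
Qed.

Lemma schur_numerator_factor (F : fieldType) (m n : nat) (x : 'I_n -> F) :
  (forall i, x i != 0) ->
  \det (\matrix_(h < n + n, t < n + n) blocks_with_inverses x h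
          ^+ (nth 0 (nseq n (2 * m + 1)) t + (n + n - t.+1))%N)
  = \det (\matrix_(h < n, t < n)
            (x h ^+ (m + (n - t))%N - x h ^- (m + (n - t))%N))
    * \det (\matrix_(h < n, t < n)
              (x h ^+ (m + (n - t))%N + x h ^- (m + (n - t))%N))
    * (-1) ^+ rev_perm n.
Proof.
move=> x_neq0.
pose A := \matrix_(h < n, t < n) x h ^+ (m + (n - t))%N.
pose B := \matrix_(h < n, t < n) x h ^- (m + (n - t))%N.
pose P : 'M[F]_n := perm_mx (rev_perm n).
(* The last [n] columns have centered exponents [-(m + 1), ..., -(m + n)], opposite in order to
   those of [B]; [P] reverses them. *)
transitivity (\det (block_mx A B B A *m block_mx 1%:M 0 0 P)); last first.
  rewrite det_mulmx det_ublock det1 mul1r det_perm det_block_swap.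
  by congr (_ * _ * _); congr (\det _); apply/matrixP => i j; rewrite !mxE.
rewrite mulmx_block !mulmx1 !mulmx0 !addr0 !add0r.
rewrite -[RHS](det_scale_with_inverses (m + n) _ x_neq0); congr (\det _).
apply/matrixP => i j; rewrite [LHS]mxE [RHS]mxE /blocks_with_inverses.
case: (split_ordP i) => h ->; case: (split_ordP j) => t ->;
  rewrite ?(unsplitK (inl _)) ?(unsplitK (inr _)) ?block_mxEul ?block_mxEur
    ?block_mxEdl ?block_mxEdr ?mulmx_rev_perm !mxE /= nth_nseq; have := ltn_ord t => lt_tn.
- by rewrite lt_tn -exprD; congr (_ ^+ _); lia.
- rewrite ltnNge leq_addr /= -exprB ?unitfE //; last lia.
  by congr (_ ^+ _); lia.
- by rewrite lt_tn -exprVn -exprD; congr (_ ^+ _); lia.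
- rewrite ltnNge leq_addr /= -[x h ^+ (m + _)]invrK -exprVn.
  rewrite -exprB ?unitfE ?invr_eq0 //; last lia.
  by congr (_ ^+ _); lia.
Qed.

Lemma schur_denominator_factor (F : fieldType) (n : nat) (x : 'I_n -> F) :
  (forall i, x i != 0) ->
  (if n is 0 then 1 else 2) *
    \det (\matrix_(h < n + n, t < n + n) blocks_with_inverses x h
            ^+ (n + n - t.+1)%N)
  = \det (\matrix_(h < n, t < n) (x h ^+ (n - t)%N - x h ^- (n - t)%N))
    * \det (\matrix_(h < n, t < n) (x h ^+ (n - t.+1)%N + x h ^- (n - t.+1)%N))
    * (-1) ^+ rev_perm n.
Proof.
move=> x_neq0.
pose C := \matrix_(h < n, t < n) x h ^+ (n - t)%N.
pose C' := \matrix_(h < n, t < n) x h ^- (n - t)%N.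
pose D := \matrix_(h < n, t < n) x h ^- t.
pose D' := \matrix_(h < n, t < n) x h ^+ t.
(* Right multiplication by [Q] moves the column of exponent [t] to position [t]. Column 0 becomes
   zero, since [n - s] is never 0. *)
pose Q : 'M[F]_n := \matrix_(s < n, t < n) (n - s == t)%N%:R.
have QE (g : 'I_n -> nat -> F) h t : ((\matrix_(h, t) g h (n - t)%N) *m Q) h t =
    if t == 0%N :> nat then 0 else g h t.
  rewrite mxE; case: eqP => t0.
    rewrite big1 // => s _; rewrite !mxE; case: eqP => [e|_]; last by rewrite mulr0.
    by exfalso; have := ltn_ord s; lia.
  have lt_s : (n - t < n)%N by have := ltn_ord t; lia.
  rewrite (bigD1 (Ordinal lt_s)) //= big1 ?addr0 => [|s].
    by rewrite !mxE /= subKn ?eqxx ?mulr1 // ltnW.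
  rewrite -val_eqE !mxE /= => /eqP ne_s; case: eqP => [e|_]; last by rewrite mulr0.
  by exfalso; have := ltn_ord s; have := ltn_ord t; lia.
have vandE : \det (\matrix_(h < n + n, t < n + n) blocks_with_inverses x h
            ^+ (n + n - t.+1)%N) = \det (block_mx C D C' D').
  rewrite -[RHS](det_scale_with_inverses n.-1 _ x_neq0); congr (\det _).
  apply/matrixP => i j; rewrite [LHS]mxE [RHS]mxE /blocks_with_inverses.
  case: (split_ordP i) => h ->; case: (split_ordP j) => t ->;
    rewrite ?(unsplitK (inl _)) ?(unsplitK (inr _)) ?block_mxEul ?block_mxEur
      ?block_mxEdl ?block_mxEdr !mxE /=; have := ltn_ord t => lt_tn.
  - by rewrite -exprD; congr (_ ^+ _); lia.
  - by rewrite -exprB ?unitfE //; [congr (_ ^+ _) | ]; lia.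
  - by rewrite -exprVn -exprD; congr (_ ^+ _); lia.
  - rewrite -[x h ^+ t]invrK -exprVn -exprB ?unitfE ?invr_eq0 //; last lia.
    by congr (_ ^+ _); lia.
(* For [t > 0] the differences [x^t - x^-t] and [x^-t - x^t] cancel; for [t = 0] the entry of
   [D - D'] is already [1 - 1]. *)
have DQ : (C - C') *m Q + (D - D') = 0.
  rewrite mulmxBl; apply/matrixP => h t; rewrite [LHS]mxE.
  rewrite [X in X + _]mxE [(- (C' *m Q)) h t]mxE.
  rewrite (QE (fun h k => x h ^+ k)) (QE (fun h k => x h ^- k)) !mxE.
  by case: eqP => [->|_]; [rewrite expr0 invr1 | ]; ring.
have E : block_mx 1%:M (- 1%:M) 0 1%:M *m block_mx C D C' D' *m
         block_mx 1%:M Q 0 1%:M = block_mx (C - C') 0 C' (C' *m Q + D').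
  rewrite !mulmx_block !mul0mx !mulmx0 !mul1mx !mulmx1 !mulNmx !mul1mx.
  by rewrite !addr0 !add0r DQ.
rewrite vandE.
have -> : \det (block_mx C D C' D') = \det (C - C') * \det (C' *m Q + D').
  have /(congr1 determinant) := E.
  by rewrite !det_mulmx !det_ublock !det1 !mul1r !mulr1 det_lblock.
have -> : \matrix_(h < n, t < n) (x h ^+ (n - t)%N - x h ^- (n - t)%N) = C - C'.
  by apply/matrixP => i j; rewrite !mxE.
rewrite mulrCA -mulrA; congr (_ * _).
(* Column 0 of [C' *m Q + D'] is constantly 1; [d] doubles it to match [x^0 + x^-0]. Reversing the
   columns then puts the exponents in decreasing order. *)
pose d (t : 'I_n) : F := if t == 0%N :> nat then 2 else 1.
have -> : (if n is 0 then 1 else 2) = \prod_t d t.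
  case: (n) @d => [|k] d; first by rewrite big_ord0.
  by rewrite big_ord_recl /= big1 ?mulr1.
rewrite -det_scale_cols -det_perm -det_mulmx; congr (\det _).
apply/matrixP => h t.
rewrite mulmx_rev_perm [LHS]mxE [RHS]mxE [(C' *m Q + D') h t]mxE.
rewrite (QE (fun h k => x h ^- k)) mxE /d /=.
have -> : (n - (n - t.+1).+1 = t)%N by have := ltn_ord t; lia.
by case: eqP => [->|_]; rewrite ?expr0 ?invr1; ring.
Qed.

(** The quotient of the two factorizations splits even where a denominator vanishes, because
    inversion is multiplicative with 0 as the inverse of 0. *)
Lemma schur_rectangle_factor (F : fieldType) (m n : nat) (x : 'I_n -> F) :
  2 != 0 :> F -> (forall i, x i != 0) ->
  schur (nseq n (2 * m + 1)%N) (with_inverses x)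
  = symplectic (nseq n m) x * even_orthogonal (nseq n (m + 1)%N) x.
Proof.
move=> two_neq0 x_neq0; rewrite schur_with_inverses /schur.
rewrite schur_numerator_factor // /symplectic /even_orthogonal.
have k_neq0 : (if n is 0 then 1 else 2) != 0 :> F by case: (n); rewrite ?oner_eq0.
(* Writing the denominator [y] as [k^-1 * (k * y)] exposes the factored product; inverting [k^-1]
   yields the leading factor of [even_orthogonal]. *)
rewrite -[X in _ / X](mulKf k_neq0) schur_denominator_factor //.
have nthE (a : nat) (t : 'I_n) : nth 0%N (nseq n a) t = a.
  by rewrite nth_nseq ltn_ord.
have -> : \matrix_(h < n, t < n)
    (x h ^+ (nth 0 (nseq n m) t + (n - t))%N
     - x h ^- (nth 0 (nseq n m) t + (n - t))%N)
  = \matrix_(h < n, t < n) (x h ^+ (m + (n - t))%N - x h ^- (m + (n - t))%N).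
  by apply/matrixP => h t; rewrite !mxE nthE.
have -> : \matrix_(h < n, t < n)
    (x h ^+ (nth 0 (nseq n (m + 1)) t + (n - t.+1))%N
     + x h ^- (nth 0 (nseq n (m + 1)) t + (n - t.+1))%N)
  = \matrix_(h < n, t < n) (x h ^+ (m + (n - t))%N + x h ^- (m + (n - t))%N).
  apply/matrixP => h t; rewrite !mxE nthE.
  (* The extra 1 in [m + 1] makes up for the lower orthogonal exponent, so both numerators have the
     exponents [m + (n - t)]. *)
  by rewrite -addnA add1n subnSK.
rewrite !invfM invrK mulrCA.
set k := (if n is 0 then 1 else 2); set s := (-1) ^+ _.
have ss : s / s = 1 by rewrite divff // signr_eq0.
set a := \det _; set b := \det _; set c := \det _; set e := \det _.
(* The sign [s] of the column reversal occurs in both numerator and denominator. *)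
by rewrite -[RHS]mulr1 -ss; ring.
Qed.

Theorem theorem2 (m n : nat) :
  schur (nseq n (2 * m + 1)%N) (with_inverses (@indet n))
  = symplectic (nseq n m) (@indet n)
    * even_orthogonal (nseq n (m + 1)%N) (@indet n).
Proof.
apply: schur_rectangle_factor => [|i].
  by rewrite -(rmorph_nat (@tofrac _)) tofrac_eq0 -mpolyC_nat mpolyC_eq0.
by rewrite tofrac_eq0 -msupp_eq0 msuppX.
Qed.
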